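(* Let $R$ be a reduced Noetherian ring of positive prime characteristic $p$ and let $N \subseteq M$ be a pair of finitely generated $R$-modules. Suppose that for every prime $Q \in \operatorname{Ass}(M/N^* )$ one has $(N_Q)^* = (N^* )_Q$. Then for every test element $c \in R^\circ$ such that $c$ is a test element in each of the rings $R_Q$ for every associated prime $Q$ of $M/N^*$, there is a test exponent for $c, N, M$. In particular, if $(N_Q)^* = (N^* )_Q$ for all associated primes $Q$ of $M/N^*$ and $c$ is a locally stable test element for $R$, then $c, N, M$ has a test exponent. Thus, if $(N_Q)^* = (N^* )_Q$ for all associated primes $Q$ of $M/N^*$, and $R$ has a locally stable test element, then tight closure commutes with localization in general for the pair $N \subseteq M$, i.e., $(N_W)^* = (N^* )_W$ (in $M_W$, over $R_W$) for every multiplicative system $W$ of $R$.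
   Context: Throughout, $q, Q'$ denote powers $p^e$, $e \in \mathbb{N}$, of $p$. $R^\circ$ denotes the complement in $R$ of the union of the minimal primes of $R$. $F^e(M)$ denotes the base change of the $R$-module $M$ along the $e$-th iterate $r \mapsto r^{p^e}$ of the Frobenius endomorphism $R \to R$. For $N \subseteq M$ and $q = p^e$, $N^{[q]}$ denotes the image of $F^e(N) \to F^e(M)$, and for $u \in M$, $u^q$ denotes $1 \otimes u \in F^e(M)$. For finitely generated $N \subseteq M$, the tight closure $N^*$ of $N$ in $M$ is the set of $u \in M$ for which there is $c \in R^\circ$ with $cu^q \in N^{[q]}$ for all $q \gg 0$; $(N_Q)^*$ is the tight closure of $N_Q$ in $M_Q$ over $R_Q$. A test element is an element $c \in R^\circ$ such that for all finitely generated $N \subseteq M$ and $u \in M$: $u \in N^*$ if and only if $cu^q \in N^{[q]}$ for all $q$. It is locally stable if its image in every local ring of $R$ is a test element of that ring. For a test element $c$ of $R$ and finitely generated $N \subseteq M$, a power $q=p^e$ is a test exponent for $c, N, M$ if whenever $u \in M$, $Q' \ge q$ is a power of $p$ and $cu^{Q'} \in N^{[Q']}$, then $u \in N^*$. *)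

(* Defs.v *)
From HB Require Import structures.
From mathcomp Require Import all_boot all_algebra ring.
From mathcomp Require Import boolp.

Set Implicit Arguments.
Unset Strict Implicit.
Unset Printing Implicit Defensive.

Import GRing.Theory.
Local Open Scope ring_scope.
Local Open Scope quotient_scope.

(* Rings are [comPzRingType], which includes the zero ring: a multiplicative
   system may contain 0, and then the localization is the zero ring. *)

(* A submodule of [V] is a [submodClosed V], and an ideal of [R] is a submodule
   of [R^o]; [submod_type N] is the submodule [N] as a module in its own right,
   with inclusion [val]. *)
Section Submodules.
Variables (R : comPzRingType) (V : lmodType R) (N : submodClosed V).

Record submod_type :=
  SubmodType { submod_val : V; submod_valP : submod_val \in N }.

HB.instance Definition _ := [isSub for submod_val].
HB.instance Definition _ := [Choice of submod_type by <:].
HB.instance Definition _ := [SubChoice_isSubLmodule of submod_type by <:].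

(* [N] as a subgroup, the form in which [Quotient.quot] expects it. *)
Definition submod_subgroup : {pred V} := [pred x | x \in N].

Lemma submod_subgroup_closed : zmod_closed submod_subgroup.
Proof.
split; first by rewrite inE rpred0.
move=> x y; rewrite !inE => Nx Ny.
by rewrite rpredD // -scaleN1r rpredZ.
Qed.
HB.instance Definition _ :=
  GRing.isZmodClosed.Build V submod_subgroup submod_subgroup_closed.

Definition quot_mod := Quotient.quot submod_subgroup.
HB.instance Definition _ := GRing.Zmodule.on quot_mod.

Definition quot_pi (x : V) : quot_mod := \pi_(Quotient.quot submod_subgroup) x.

Lemma quot_piE x y : (quot_pi x = quot_pi y) <-> (x - y \in N).
Proof.
rewrite /quot_pi.
have -> : (x - y \in N) = (x - y \in submod_subgroup) by [].
by rewrite Quotient.idealrBE; split => [->|/eqP].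
Qed.

Lemma quot_pi_repr (y : quot_mod) : quot_pi (repr y) = y.
Proof. exact: reprK. Qed.

Lemma quot_piD x y : quot_pi (x + y) = quot_pi x + quot_pi y.
Proof. by rewrite /quot_pi raddfD. Qed.

Definition quot_scale (a : R) (y : quot_mod) : quot_mod := quot_pi (a *: repr y).

Lemma quot_scale_pi a x : quot_scale a (quot_pi x) = quot_pi (a *: x).
Proof.
by apply/quot_piE; rewrite -scalerBr rpredZ //; apply/quot_piE/quot_pi_repr.
Qed.

Lemma quot_scaleA a b v : quot_scale a (quot_scale b v) = quot_scale (a * b) v.
Proof. by rewrite -[v]quot_pi_repr !quot_scale_pi scalerA. Qed.
Lemma quot_scale1 : left_id 1 quot_scale.
Proof. by move=> v; rewrite -[v]quot_pi_repr !quot_scale_pi scale1r. Qed.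
Lemma quot_scaleDr : right_distributive quot_scale +%R.
Proof.
move=> a u v; rewrite -[u]quot_pi_repr -[v]quot_pi_repr -quot_piD.
by rewrite !quot_scale_pi scalerDr quot_piD.
Qed.
Lemma quot_scaleDl v : {morph quot_scale^~ v : a b / a + b}.
Proof.
by move=> a b; rewrite -[v]quot_pi_repr !quot_scale_pi scalerDl quot_piD.
Qed.
HB.instance Definition _ := GRing.Zmodule_isLmodule.Build R quot_mod
  quot_scaleA quot_scale1 quot_scaleDr quot_scaleDl.

End Submodules.

(* Base change S (x)_R M along f : R -> S, by generators and relations: formal
   sums of pairs (s, m), i.e. of s (x) m, are lists up to the congruence
   generated by commutativity of the sum and the relations below.  The
   construction does not need a proof that [f] is a ring morphism. *)
Section BaseChange.
Variables (R S : comPzRingType) (f : R -> S) (M : lmodType R).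

Inductive tensor_rel : seq (S * M) -> seq (S * M) -> Prop :=
| tensor_refl s : tensor_rel s s
| tensor_sym s t : tensor_rel s t -> tensor_rel t s
| tensor_trans t s u : tensor_rel s t -> tensor_rel t u -> tensor_rel s u
| tensor_cat s s' t t' :
    tensor_rel s s' -> tensor_rel t t' -> tensor_rel (s ++ t) (s' ++ t')
| tensor_catC s t : tensor_rel (s ++ t) (t ++ s)
| tensor_0l m : tensor_rel [:: (0, m)] [::]
| tensor_Dl a b m : tensor_rel [:: (a + b, m)] [:: (a, m); (b, m)]
| tensor_Dr a m n : tensor_rel [:: (a, m + n)] [:: (a, m); (a, n)]
| tensor_M a r m : tensor_rel [:: (a * f r, m)] [:: (a, r *: m)].

Definition tensor_equiv (s t : seq (S * M)) := `[< tensor_rel s t >].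

Lemma tensor_equiv_is_equiv : equiv_class_of tensor_equiv.
Proof.
split=> [s|s t|t s u].
- exact/asboolP/tensor_refl.
- by apply/asboolP/asboolP; apply: tensor_sym.
- by move=> /asboolP st /asboolP tu; apply/asboolP/(tensor_trans st).
Qed.
Canonical tensor_equiv_equiv := EquivRelPack tensor_equiv_is_equiv.
Canonical tensor_equiv_encModRel := defaultEncModRel tensor_equiv.

Definition base_change := {eq_quot tensor_equiv}.
HB.instance Definition _ := EqQuotient.on base_change.
HB.instance Definition _ := Choice.on base_change.

Definition bc_pi (s : seq (S * M)) : base_change := \pi_base_change s.

Lemma bc_piE s t : bc_pi s = bc_pi t <-> tensor_rel s t.
Proof.
rewrite /bc_pi; split; first by move/eqmodP/asboolP.
by move=> st; apply/eqmodP/asboolP.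
Qed.
Lemma bc_pi_repr y : bc_pi (repr y) = y. Proof. exact: reprK. Qed.
Lemma repr_bc_pi s : tensor_rel (repr (bc_pi s)) s.
Proof. exact/bc_piE/bc_pi_repr. Qed.

Definition tensor_scale (a : S) (s : seq (S * M)) := [seq (a * x.1, x.2) | x <- s].

Lemma tensor_scale_rel a s t :
  tensor_rel s t -> tensor_rel (tensor_scale a s) (tensor_scale a t).
Proof.
elim=> {s t}.
- by move=> s; apply: tensor_refl.
- by move=> s t _; apply: tensor_sym.
- by move=> t s u _ h1 _; apply: tensor_trans.
- by move=> s s' t t' _ h1 _ h2; rewrite /tensor_scale !map_cat; apply: tensor_cat.
- by move=> s t; rewrite /tensor_scale !map_cat; apply: tensor_catC.
- by move=> m; rewrite /= mulr0; apply: tensor_0l.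
- by move=> b c m; rewrite /= mulrDr; apply: tensor_Dl.
- by move=> b m n; apply: tensor_Dr.
- by move=> b r m; rewrite /= mulrA; apply: tensor_M.
Qed.

Lemma tensor_scale0 s : tensor_rel (tensor_scale 0 s) [::].
Proof.
elim: s => [|[a m] s IHs]; first exact: tensor_refl.
apply: (@tensor_cat [:: (0 * a, m)] [::] _ [::]) => //.
by rewrite mul0r; apply: tensor_0l.
Qed.

Lemma tensor_scaleD a b s :
  tensor_rel (tensor_scale (a + b) s) (tensor_scale a s ++ tensor_scale b s).
Proof.
elim: s => [|[c m] s IHs]; first exact: tensor_refl.
rewrite /= mulrDl.
apply: (tensor_trans (tensor_cat (tensor_Dl _ _ _) IHs)).
rewrite -[X in tensor_rel X _]/([:: (a * c, m)] ++ [:: (b * c, m)] ++ _ ++ _).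
rewrite -[X in tensor_rel _ X]/([:: (a * c, m)] ++ _ ++ [:: (b * c, m)] ++ _).
apply: tensor_cat; first exact: tensor_refl.
rewrite !catA; apply: tensor_cat; last exact: tensor_refl.
exact: tensor_catC.
Qed.

Definition bc_zero := bc_pi [::].
Definition bc_add (x y : base_change) := bc_pi (repr x ++ repr y).
Definition bc_scale (a : S) (x : base_change) := bc_pi (tensor_scale a (repr x)).
Definition bc_opp := bc_scale (- 1).

Lemma bc_add_pi s t : bc_add (bc_pi s) (bc_pi t) = bc_pi (s ++ t).
Proof. by apply/bc_piE/tensor_cat; apply: repr_bc_pi. Qed.
Lemma bc_scale_pi a s : bc_scale a (bc_pi s) = bc_pi (tensor_scale a s).
Proof. exact/bc_piE/tensor_scale_rel/repr_bc_pi. Qed.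

Lemma bc_addA : associative bc_add.
Proof.
move=> x y z; rewrite -[x]bc_pi_repr -[y]bc_pi_repr -[z]bc_pi_repr.
by rewrite !bc_add_pi catA.
Qed.
Lemma bc_addC : commutative bc_add.
Proof. by move=> x y; apply/bc_piE/tensor_catC. Qed.
Lemma bc_add0 : left_id bc_zero bc_add.
Proof. by move=> x; rewrite -[x]bc_pi_repr bc_add_pi. Qed.
Lemma bc_scaleDl v a b : bc_scale (a + b) v = bc_add (bc_scale a v) (bc_scale b v).
Proof.
by rewrite -[v]bc_pi_repr !bc_scale_pi bc_add_pi; apply/bc_piE/tensor_scaleD.
Qed.
Lemma bc_scale1 : left_id 1 bc_scale.
Proof.
move=> v; rewrite -[v]bc_pi_repr bc_scale_pi /tensor_scale.
by under eq_map => x do rewrite mul1r -surjective_pairing; rewrite map_id.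
Qed.
Lemma bc_addN : left_inverse bc_zero bc_opp bc_add.
Proof.
move=> x; rewrite -[X in bc_add _ X]bc_scale1 -bc_scaleDl addNr.
exact/bc_piE/tensor_scale0.
Qed.
HB.instance Definition _ :=
  GRing.isZmodule.Build base_change bc_addA bc_addC bc_add0 bc_addN.

Lemma bc_scaleA a b v : bc_scale a (bc_scale b v) = bc_scale (a * b) v.
Proof.
rewrite -[v]bc_pi_repr !bc_scale_pi /tensor_scale -map_comp /=.
by congr bc_pi; apply: eq_map => x /=; rewrite mulrA.
Qed.
Lemma bc_scaleDr : right_distributive bc_scale +%R.
Proof.
move=> a u v; change (bc_scale a (bc_add u v) = bc_add (bc_scale a u) (bc_scale a v)).
rewrite -[u]bc_pi_repr -[v]bc_pi_repr.
by rewrite !(bc_scale_pi, bc_add_pi) /tensor_scale map_cat.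
Qed.
HB.instance Definition _ := GRing.Zmodule_isLmodule.Build S base_change
  bc_scaleA bc_scale1 bc_scaleDr bc_scaleDl.

(* s (x) m *)
Definition tensor (s : S) (m : M) : base_change := bc_pi [:: (s, m)].

Lemma bc_piS s : bc_pi s = \sum_(x <- s) tensor x.1 x.2.
Proof.
elim: s => [|[a m] s IHs]; first by rewrite big_nil.
by rewrite big_cons -IHs -[LHS](@bc_add_pi [:: (a, m)]).
Qed.
Lemma bc_spanned (y : base_change) :
  exists s : seq (S * M), y = \sum_(x <- s) tensor x.1 x.2.
Proof. by exists (repr y); rewrite -bc_piS bc_pi_repr. Qed.
Lemma tensorZl a b m : a *: tensor b m = tensor (a * b) m.
Proof. exact: bc_scale_pi. Qed.
Lemma tensorDr a m n : tensor a (m + n) = tensor a m + tensor a n.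
Proof.
by rewrite [RHS](bc_add_pi [:: _] [:: _]); apply/bc_piE/tensor_Dr.
Qed.
Lemma tensorZr a r m : tensor a (r *: m) = tensor (a * f r) m.
Proof. exact/esym/bc_piE/tensor_M. Qed.

(* Universal property. *)
Section Lift.
Variables (P : lmodType S) (g : M -> P).
Hypothesis gD : {morph g : m n / m + n}.
Hypothesis gZ : forall r m, g (r *: m) = f r *: g m.

Definition bc_lift (y : base_change) : P := \sum_(x <- repr y) x.1 *: g x.2.

Lemma bc_lift_pi s : bc_lift (bc_pi s) = \sum_(x <- s) x.1 *: g x.2.
Proof.
rewrite /bc_lift; have := repr_bc_pi s; move: (repr _) => t.
elim=> {s t} //.
- by move=> t s u _ -> _ ->.
- by move=> s s' t t' _ h1 _ h2; rewrite !big_cat h1 h2.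
- by move=> s t; rewrite !big_cat /= addrC.
- by move=> m; rewrite big_seq1 big_nil scale0r.
- by move=> a b m; rewrite big_seq1 big_cons big_seq1 scalerDl.
- by move=> a m n; rewrite big_seq1 big_cons big_seq1 gD scalerDr.
- by move=> a r m; rewrite !big_seq1 gZ scalerA.
Qed.
Lemma bc_liftT a m : bc_lift (tensor a m) = a *: g m.
Proof. by rewrite bc_lift_pi big_seq1. Qed.
Lemma bc_lift_linear : linear bc_lift.
Proof.
move=> a u v; rewrite -[u]bc_pi_repr -[v]bc_pi_repr.
rewrite [_ *: _]bc_scale_pi [_ + bc_pi _]bc_add_pi !bc_lift_pi big_cat /=.
rewrite scaler_sumr big_map; congr (_ + _).
by apply: eq_bigr => x _; rewrite scalerA.
Qed.
End Lift.

End BaseChange.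

Arguments tensor {R S} f {M} s m.

(* S (x)_R h : S (x)_R M -> S (x)_R M' *)
Definition bc_map (R S : comPzRingType) (f : R -> S) (M M' : lmodType R)
  (h : {linear M -> M'}) : base_change f M -> base_change f M' :=
  bc_lift (fun m => tensor f 1 (h m)).

Section BaseChangeMap.
Variables (R S : comPzRingType) (f : R -> S) (M M' : lmodType R).
Variable h : {linear M -> M'}.

Lemma bc_mapD : {morph (fun m => tensor f 1 (h m)) : m n / m + n}.
Proof. by move=> m n; rewrite linearD tensorDr. Qed.
Lemma bc_mapZ r m : tensor f 1 (h (r *: m)) = f r *: tensor f 1 (h m).
Proof. by rewrite linearZ tensorZr tensorZl mulrC. Qed.
Lemma bc_mapT a m : bc_map h (tensor f a m) = tensor f a (h m).
Proof.
by rewrite /bc_map bc_liftT ?tensorZl ?mulr1 //; [exact: bc_mapD|exact: bc_mapZ].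
Qed.
Lemma bc_map_linear : linear (@bc_map _ _ f _ _ h).
Proof. apply: bc_lift_linear; [exact: bc_mapD|exact: bc_mapZ]. Qed.
HB.instance Definition _ := GRing.isLinear.Build S (base_change f M)
  (base_change f M') *:%R (@bc_map _ _ f _ _ h) bc_map_linear.
End BaseChangeMap.

(* Localization W^-1 M: classes of fractions m/w, where m/w = n/v if and only
   if t v m = t w n for some t in W. *)
Section LocalizationModule.
Variables (R : comPzRingType) (W : mulrClosed R) (M : lmodType R).

Definition denom := {w : R | w \in W}.
Definition denom1 : denom := exist _ 1 (rpred1 W).
Lemma denomM_subproof (v w : denom) : val v * val w \in W.
Proof. by rewrite rpredM ?(valP v) ?(valP w). Qed.
Definition denomM (v w : denom) : denom :=
  exist _ (val v * val w) (denomM_subproof v w).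

Definition frac_rel (x y : M * denom) :=
  exists2 t : R, t \in W & (t * val y.2) *: x.1 = (t * val x.2) *: y.1.
Definition frac_equiv (x y : M * denom) := `[< frac_rel x y >].

Lemma frac_equiv_is_equiv : equiv_class_of frac_equiv.
Proof.
split=> [x|x y|y x z].
- by apply/asboolP; exists 1; rewrite ?rpred1.
- by apply/asboolP/asboolP => -[t Wt e]; exists t.
- move=> /asboolP[t Wt e] /asboolP[t' Wt' e']; apply/asboolP.
  exists (t * t' * val y.2); first by rewrite !rpredM // (valP y.2).
  have -> : t * t' * val y.2 * val z.2 = (t' * val z.2) * (t * val y.2) by ring.
  rewrite -scalerA e scalerA.
  have -> : t' * val z.2 * (t * val x.2) = (t * val x.2) * (t' * val z.2) by ring.
  rewrite -scalerA e' scalerA; congr (_ *: _); ring.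
Qed.
Canonical frac_equiv_equiv := EquivRelPack frac_equiv_is_equiv.
Canonical frac_equiv_encModRel := defaultEncModRel frac_equiv.

Definition loc_mod := {eq_quot frac_equiv}.
HB.instance Definition _ := EqQuotient.on loc_mod.
HB.instance Definition _ := Choice.on loc_mod.

Definition frac (m : M) (w : denom) : loc_mod := \pi_loc_mod (m, w).

Lemma fracE m v n w :
  frac m v = frac n w <->
  exists2 t : R, t \in W & (t * val w) *: m = (t * val v) *: n.
Proof.
rewrite /frac; split; first by move/eqmodP/asboolP.
by move=> e; apply/eqmodP/asboolP.
Qed.
Lemma frac_repr (x : loc_mod) : frac (repr x).1 (repr x).2 = x.
Proof. by rewrite /frac -surjective_pairing reprK. Qed.
Lemma fracP (x : loc_mod) : exists m w, x = frac m w.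
Proof. by exists (repr x).1, (repr x).2; rewrite frac_repr. Qed.
Lemma repr_frac m w : exists2 t : R, t \in W &
  (t * val w) *: (repr (frac m w)).1 = (t * val (repr (frac m w)).2) *: m.
Proof. by apply/fracE; rewrite frac_repr. Qed.

Definition loc_zero : loc_mod := frac 0 denom1.
Definition loc_add (x y : loc_mod) : loc_mod :=
  let: (m, v) := repr x in let: (n, w) := repr y in
  frac (val w *: m + val v *: n) (denomM v w).
Definition loc_opp (x : loc_mod) : loc_mod :=
  let: (m, v) := repr x in frac (- m) v.

Lemma loc_add_frac m v n w :
  loc_add (frac m v) (frac n w) = frac (val w *: m + val v *: n) (denomM v w).
Proof.
rewrite /loc_add; case: (repr _) (repr_frac m v) => m' v' /= [t Wt e].
case: (repr _) (repr_frac n w) => n' w' /= [t' Wt' e'].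
apply/fracE; exists (t * t'); rewrite ?rpredM //= !scalerDr !scalerA.
congr (_ + _).
  have -> : t * t' * (val v * val w) * val w'
    = (t' * val w * val w') * (t * val v) by ring.
  by rewrite -scalerA e scalerA; congr (_ *: _); rewrite /=; ring.
have -> : t * t' * (val v * val w) * val v'
  = (t * val v * val v') * (t' * val w) by ring.
by rewrite -scalerA e' scalerA; congr (_ *: _); rewrite /=; ring.
Qed.
Lemma loc_opp_frac m v : loc_opp (frac m v) = frac (- m) v.
Proof.
rewrite /loc_opp; case: (repr _) (repr_frac m v) => m' v' /= [t Wt e].
by apply/fracE; exists t; rewrite // !scalerN e.
Qed.

Lemma frac_eq m v n w : val w *: m = val v *: n -> frac m v = frac n w.
Proof. by move=> e; apply/fracE; exists 1; rewrite ?rpred1 // !mul1r. Qed.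

Lemma loc_addA : associative loc_add.
Proof.
move=> x y z; have [m [u ->]] := fracP x; have [n [v ->]] := fracP y.
have [k [w ->]] := fracP z; rewrite !loc_add_frac /=.
apply: frac_eq => /=; rewrite !scalerDr !scalerA addrA.
by congr (_ *: _ + _ *: _ + _ *: _); rewrite /=; ring.
Qed.
Lemma loc_addC : commutative loc_add.
Proof.
move=> x y; have [m [u ->]] := fracP x; have [n [v ->]] := fracP y.
rewrite !loc_add_frac; apply: frac_eq => /=.
by rewrite !scalerDr !scalerA addrC; congr (_ *: _ + _ *: _); rewrite /=; ring.
Qed.
Lemma loc_add0 : left_id loc_zero loc_add.
Proof.
move=> x; have [m [u ->]] := fracP x; rewrite loc_add_frac.
by apply: frac_eq => /=; rewrite scaler0 add0r scale1r mul1r.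
Qed.
Lemma loc_addN : left_inverse loc_zero loc_opp loc_add.
Proof.
move=> x; have [m [u ->]] := fracP x; rewrite loc_opp_frac loc_add_frac.
by apply: frac_eq => /=; rewrite scalerN addNr !scaler0.
Qed.
HB.instance Definition _ :=
  GRing.isZmodule.Build loc_mod loc_addA loc_addC loc_add0 loc_addN.

Lemma fracD m v n w :
  frac m v + frac n w = frac (val w *: m + val v *: n) (denomM v w).
Proof. exact: loc_add_frac. Qed.

End LocalizationModule.

Section LocalizationScale.
Variables (R : comPzRingType) (W : mulrClosed R) (M : lmodType R).
Implicit Types (a b : loc_mod W R^o) (x y : loc_mod W M).

(* (a/v) (m/w) = (a m)/(v w) *)
Definition loc_scale a x : loc_mod W M :=
  let: (c, v) := repr a in let: (m, w) := repr x in frac ((c : R) *: m) (denomM v w).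

Lemma loc_scale_frac (c : R) v m w :
  loc_scale (frac (c : R^o) v) (frac m w) = frac (c *: m) (denomM v w).
Proof.
rewrite /loc_scale; case: (repr _) (repr_frac (c : R^o) v) => c' v' /= [t Wt e].
case: (repr _) (repr_frac m w) => m' w' /= [t' Wt' e'].
apply/fracE; exists (t * t'); rewrite ?rpredM //= !scalerA.
have -> : t * t' * (val v * val w) * (c' : R)
  = (t * val v * (c' : R)) * (t' * val w) by ring.
rewrite -scalerA e' scalerA [t * _ * _]e; congr (_ *: _).
by rewrite /(_ *: _) /=; ring.
Qed.

Lemma loc_scaleDr : right_distributive loc_scale +%R.
Proof.
move=> a x y; have [c [u ->]] := fracP a; have [n [v ->]] := fracP x.
have [k [w ->]] := fracP y; rewrite fracD !loc_scale_frac fracD.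
apply: frac_eq => /=; rewrite !scalerDr !scalerA.
by congr (_ *: _ + _ *: _); rewrite /=; ring.
Qed.
Lemma loc_scaleDl x : {morph loc_scale^~ x : a b / a + b}.
Proof.
move=> a b; have [c [u ->]] := fracP a; have [d [v ->]] := fracP b.
have [k [w ->]] := fracP x; rewrite fracD !loc_scale_frac fracD.
apply: frac_eq => /=; rewrite !scalerDr !scalerA -scalerDl; congr (_ *: _).
change (sval u * sval w * (sval v * sval w) * (sval v * c + sval u * d) =
  sval u * sval v * sval w * (sval v * sval w * c) +
  sval u * sval v * sval w * (sval u * sval w * d) :> R); ring.
Qed.
End LocalizationScale.

Section LocalizationRing.
Variables (R : comPzRingType) (W : mulrClosed R).

Definition loc_ring := loc_mod W R^o.
HB.instance Definition _ := GRing.Zmodule.on loc_ring.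

Definition loc_one : loc_ring := frac (1 : R^o) (denom1 W).
Definition loc_mul (a b : loc_ring) : loc_ring := loc_scale a b.

Lemma loc_scaleA (M : lmodType R) (a b : loc_ring) (x : loc_mod W M) :
  loc_scale a (loc_scale b x) = loc_scale (loc_mul a b) x.
Proof.
have [c [u ->]] := fracP a; have [d [v ->]] := fracP b.
have [k [w ->]] := fracP x; rewrite /loc_mul !loc_scale_frac.
by apply: frac_eq => /=; rewrite !scalerA; congr (_ *: _); rewrite /= -!mulrA.
Qed.
Lemma loc_scale1 (M : lmodType R) : left_id loc_one (@loc_scale _ W M).
Proof.
move=> x; have [k [w ->]] := fracP x; rewrite loc_scale_frac.
by apply: frac_eq => /=; rewrite !scalerA; congr (_ *: _); rewrite /=; ring.
Qed.
Lemma loc_mulA : associative loc_mul.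
Proof. by move=> a b c; rewrite /loc_mul loc_scaleA. Qed.
Lemma loc_mulC : commutative loc_mul.
Proof.
move=> a b; have [c [u ->]] := fracP a; have [d [v ->]] := fracP b.
rewrite /loc_mul !loc_scale_frac; apply: frac_eq => /=.
by rewrite [c *: d]mulrC; congr (_ *: _); rewrite /=; ring.
Qed.
Lemma loc_mulDl : left_distributive loc_mul +%R.
Proof. by move=> a b c; rewrite /loc_mul loc_scaleDl. Qed.
HB.instance Definition _ := GRing.Zmodule_isComPzRing.Build loc_ring
  loc_mulA loc_mulC (@loc_scale1 R^o) loc_mulDl.
End LocalizationRing.

HB.instance Definition _ (R : comPzRingType) (W : mulrClosed R) (M : lmodType R) :=
  GRing.Zmodule_isLmodule.Build (loc_ring W) (loc_mod W M)
    (@loc_scaleA R W M) (@loc_scale1 R W M) (@loc_scaleDr R W M) (@loc_scaleDl R W M).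

(* The image r/1 of [r] in W^-1 R. *)
Definition loc_image (R : comPzRingType) (W : mulrClosed R) (r : R) : loc_ring W :=
  frac (r : R^o) (denom1 W).

(* The image {n/w | n in N, w in W} of W^-1 N in W^-1 M. *)
Section LocalizationSubmodule.
Variables (R : comPzRingType) (W : mulrClosed R) (M : lmodType R).
Variable N : submodClosed M.

Definition loc_submod : {pred loc_mod W M} :=
  fun x => `[< exists2 n, n \in N & exists w, x = frac n w >].

Lemma loc_submod_closed : GRing.submod_closed loc_submod.
Proof.
split; first by apply/asboolP; exists 0; rewrite ?rpred0 //; exists (denom1 W).
move=> a _ _ /asboolP[m Nm [v ->]] /asboolP[n Nn [w ->]].
have [c [u ->]] := fracP a; rewrite [_ *: _]loc_scale_frac fracD.
apply/asboolP; exists (val w *: (c *: m) + val (denomM u v) *: n).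
  by rewrite rpredD // !rpredZ.
by exists (denomM (denomM u v) w).
Qed.
HB.instance Definition _ := GRing.isSubmodClosed.Build (loc_ring W) (loc_mod W M)
  loc_submod loc_submod_closed.
End LocalizationSubmodule.
Arguments loc_submod {R} W {M} N.

Definition fin_gen (R : comPzRingType) (V : lmodType R) :=
  exists (n : nat) (g : 'I_n -> V),
    forall x, exists a : 'I_n -> R, x = \sum_(i < n) a i *: g i.

Definition noetherian (R : comPzRingType) :=
  forall I : submodClosed R^o, fin_gen (submod_type I).

Definition reduced (R : comPzRingType) :=
  forall (x : R) (n : nat), x ^+ n = 0 -> x = 0.

Record prime_ideal (R : comPzRingType) := PrimeIdeal {
  prime_submod :> submodClosed R^o;
  prime_proper : (1 : R^o) \notin prime_submod;
  prime_mul : forall a b : R,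
    (a * b : R^o) \in prime_submod ->
    (a : R^o) \in prime_submod \/ (b : R^o) \in prime_submod
}.

Section Primes.
Variable R : comPzRingType.
Implicit Types P Q : prime_ideal R.

Definition prime_compl Q : {pred R} := [pred r : R | (r : R^o) \notin Q].

Lemma prime_compl_closed Q : mulr_closed (prime_compl Q).
Proof.
split; first exact: prime_proper.
move=> a b Qa Qb; rewrite inE; apply/negP => /prime_mul[].
  exact/negP.
exact/negP.
Qed.
HB.instance Definition _ Q :=
  GRing.isMulClosed.Build R (prime_compl Q) (prime_compl_closed Q).

Definition minimal_prime P :=
  forall P', {subset P' <= P} -> {subset P <= P'}.

(* c lies in the complement of the union of the minimal primes. *)
Definition circ (c : R) := forall P, minimal_prime P -> (c : R^o) \notin P.

(* Q is the annihilator of an element of V. *)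
Definition associated (V : lmodType R) Q :=
  exists u : V, forall r : R, (r : R^o) \in Q <-> r *: u = 0.
End Primes.

Section Frobenius.
Variables (p : nat) (R : comPzRingType).

Definition frob (e : nat) (r : R) : R := r ^+ (p ^ e).

(* F^e(M), when p is the characteristic of R. *)
Definition frob_mod (e : nat) (M : lmodType R) : lmodType R :=
  base_change (frob e) M.

(* u^q = 1 (x) u, for q = p ^ e. *)
Definition frob_elt (M : lmodType R) (e : nat) (u : M) : frob_mod e M :=
  tensor (frob e) 1 u.

(* N^[q], the image of F^e(N) -> F^e(M), for q = p ^ e. *)
Definition frob_submod (M : lmodType R) (e : nat) (N : submodClosed M) :
    {pred frob_mod e M} :=
  fun y => `[< exists z : frob_mod e (submod_type N),
                 y = bc_map (val : {linear submod_type N -> M}) z >].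
End Frobenius.

Arguments frob_elt p {R M} e u.
Arguments frob_submod p {R M} e N.

Section TightClosure.
Variables (p : nat) (R : comPzRingType) (M : lmodType R) (N : submodClosed M).

Lemma frob_submod_closed e : GRing.submod_closed (frob_submod p e N).
Proof.
split; first by apply/asboolP; exists 0; rewrite raddf0.
move=> a _ _ /asboolP[y ->] /asboolP[z ->]; apply/asboolP.
by exists (a *: y + z); rewrite linearP.
Qed.
HB.instance Definition _ e := GRing.isSubmodClosed.Build R (frob_mod p e M)
  (frob_submod p e N) (frob_submod_closed e).

Definition tight_closure : {pred M} := fun u =>
  `[< exists2 c : R, circ c &
        exists e0 : nat, forall e : nat, (e0 <= e)%N ->
          c *: frob_elt p e u \in frob_submod p e N >].

Lemma circ1 : circ (1 : R).
Proof. by move=> P _; apply: prime_proper. Qed.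
Lemma circM (c d : R) : circ c -> circ d -> circ (c * d).
Proof.
move=> hc hd P hP; apply/negP => /prime_mul[].
  exact/negP/hc.
exact/negP/hd.
Qed.

Lemma frob_elt_lin e a (u v : M) :
  frob_elt p e (a *: u + v) = frob p e a *: frob_elt p e u + frob_elt p e v.
Proof. by rewrite /frob_elt tensorDr tensorZr tensorZl mulrC. Qed.

Lemma tight_closure_closed : GRing.submod_closed tight_closure.
Proof.
split.
  apply/asboolP; exists 1; first exact: circ1.
  exists 0%N => e _.
  have -> : frob_elt p e (0 : M) = 0.
    by apply: (@addrI _ (frob_elt p e (0 : M))); rewrite -tensorDr !addr0.
  by rewrite scaler0 rpred0.
move=> a u v /asboolP[c Rc [e0 hu]] /asboolP[d Rd [e1 hv]]; apply/asboolP.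
exists (c * d); first exact: circM.
exists (maxn e0 e1) => e; rewrite geq_max => /andP[/hu {}hu /hv {}hv].
rewrite frob_elt_lin scalerDr rpredD //; last by rewrite -scalerA rpredZ.
rewrite scalerA; have -> : c * d * frob p e a = (d * frob p e a) * c by ring.
by rewrite -scalerA rpredZ.
Qed.
HB.instance Definition _ :=
  GRing.isSubmodClosed.Build R M tight_closure tight_closure_closed.
End TightClosure.
Arguments tight_closure p {R M} N.

Section TestElements.
Variables (p : nat) (R : comPzRingType).

Definition test_element (c : R) :=
  circ c /\
  forall (M : lmodType R) (N : submodClosed M),
    fin_gen M -> fin_gen (submod_type N) ->
    forall u : M, u \in tight_closure p N <->
      (forall e : nat, c *: frob_elt p e u \in frob_submod p e N).

(* q = p ^ e is a test exponent for c, N, M. *)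
Definition test_exponent (c : R) (M : lmodType R) (N : submodClosed M) (e : nat) :=
  forall (u : M) (e' : nat), (p ^ e <= p ^ e')%N ->
    c *: frob_elt p e' u \in frob_submod p e' N -> u \in tight_closure p N.
End TestElements.

Definition locally_stable_test_element (p : nat) (R : comPzRingType) (c : R) :=
  test_element p c /\
  forall Q : prime_ideal R, test_element p (loc_image (prime_compl Q) c).

(* Main.v *)
(** Let q = p^e, let K_e = { u : c u^q \in (N^[q])^* }, and let L = N^*.  The K_e
    decrease to L, because c is a test element, and K_e contains every u with
    c u^q \in N^[q]; so q is a test exponent as soon as K_e = L.

    If K_e <> L for all e, choose u_k \in K_{e_k} whose annihilator modulo L is a
    prime Q_k.  Since c is a test element of R_{Q_k} and tight closure of N
    commutes with localization at Q_k, there is e_{k+1} >= e_k such that no s u_k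
    with s \notin Q_k lies in K_{e_{k+1}}.  By the ascending chain condition some
    u_k is a combination of the earlier u_i; its terms a_i u_i then lie in L one
    after the other, so u_k \in L, a contradiction.

    For a multiplicative system W and u/1 \in (N_W)^*, local stability gives
    c u^q \in N^[q] locally at every prime disjoint from W, hence
    w c u^q \in N^[q] for some w \in W; then c (w u)^q \in N^[q], and w u \in N^*
    when q is a test exponent. *)

From HB Require Import structures.
From mathcomp Require Import all_boot all_algebra ring.
From mathcomp Require Import boolp.
Require Import Defs.

Set Implicit Arguments.
Unset Strict Implicit.
Unset Printing Implicit Defensive.

Import GRing.Theory.
Local Open Scope ring_scope.

(** * Submodules as predicates and spans of finite lists *)

Section Span.
Variables (R : comPzRingType) (V : lmodType R).
Implicit Types (K L : V -> Prop) (g h : seq V) (x y : V).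

(** [Prop]-valued, so that preimages, intersections and unions of chains are formed without passing
    through booleans. *)
Definition is_submod K := K 0 /\ forall a x y, K x -> K y -> K (a *: x + y).

Lemma is_submodD K x y : is_submod K -> K x -> K y -> K (x + y).
Proof. by move=> [_ KP] Kx Ky; rewrite -[x]scale1r; apply: KP. Qed.

Lemma is_submodZ K a x : is_submod K -> K x -> K (a *: x).
Proof. by move=> [K0 KP] Kx; rewrite -[_ *: _]addr0; apply: KP. Qed.

Lemma is_submodB K x y : is_submod K -> K x -> K y -> K (x - y).
Proof.
by move=> sK Kx Ky; apply: is_submodD => //; rewrite -scaleN1r; apply: is_submodZ.
Qed.

Lemma is_submod_sum K (I : Type) (r : seq I) (P : pred I) (F : I -> V) :
  is_submod K -> (forall i, P i -> K (F i)) -> K (\sum_(i <- r | P i) F i).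
Proof.
by move=> sK KF; apply: big_ind => //; [case: sK | move=> x y; apply: is_submodD].
Qed.

Lemma is_submod_mem (N : submodClosed V) : is_submod (fun x => x \in N).
Proof. by split=> [|a x y Nx Ny]; rewrite ?rpred0 // rpredD // rpredZ. Qed.

(** The proof [sK] is an argument so that the [submodClosed] instance can be attached to the
    term. *)
Definition submod_pred K (sK : is_submod K) : {pred V} := fun x => `[< K x >].

Lemma submod_pred_closed K (sK : is_submod K) :
  GRing.submod_closed (submod_pred sK).
Proof.
split; first by apply/asboolP; case: sK.
by move=> a x y /asboolP Kx /asboolP Ky; apply/asboolP; case: sK => _; apply.
Qed.
HB.instance Definition _ K (sK : is_submod K) :=
  GRing.isSubmodClosed.Build R V (submod_pred sK) (submod_pred_closed sK).

Fixpoint spanned g x : Prop :=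
  if g is v :: g' then exists a, spanned g' (x - a *: v) else x = 0.

Lemma spanned_submod g : is_submod (spanned g).
Proof.
elim: g => [|v g [IH0 IHP]]; split=> //=.
- by move=> a _ _ -> ->; rewrite scaler0 addr0.
- by exists 0; rewrite scale0r subr0.
- move=> a x y [b xb] [c yc]; exists (a * b + c).
  have -> : a *: x + y - (a * b + c) *: v = a *: (x - b *: v) + (y - c *: v).
    by rewrite scalerBr scalerDl scalerA opprD addrACA.
  exact: IHP.
Qed.

Lemma spanned_mem g x : x \in g -> spanned g x.
Proof.
elim: g => //= v g IHg; rewrite in_cons => /predU1P[->|/IHg gx].
  by exists 1; rewrite scale1r subrr; case: (spanned_submod g).
by exists 0; rewrite scale0r subr0.
Qed.

Lemma spanned_min K g x :
  is_submod K -> {in g, forall v, K v} -> spanned g x -> K x.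
Proof.
move=> sK; elim: g x => [|v g IHg] x Kg /=; first by move=> ->; case: sK.
case=> a /IHg Kxa; rewrite -[x](subrK (a *: v)).
apply: is_submodD => //; first apply: Kxa => w gw.
  by apply: Kg; rewrite in_cons gw orbT.
by apply: is_submodZ => //; apply: Kg; rewrite mem_head.
Qed.

Lemma fin_gen_spanned : fin_gen V -> exists g, forall x, spanned g x.
Proof.
case=> n [g gP]; exists [seq g i | i : 'I_n] => x; have [a ->] := gP x.
apply: is_submod_sum => [|i _]; first exact: spanned_submod.
by apply: is_submodZ; [exact: spanned_submod | apply/spanned_mem/image_f].
Qed.

Lemma spanned_fin_gen g : (forall x, spanned g x) -> fin_gen V.
Proof.
move=> gP; exists (size g), (tnth (in_tuple g)) => x.
move: (gP x) => {gP}; elim: g x => [|v g IHg] x /=.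
  by move=> ->; exists (fun=> 0); rewrite big_ord0.
case=> b /IHg[a e]; exists (fun i => oapp a b (unlift ord0 i)).
rewrite big_ord_recl unlift_none /= -[LHS](subrK (b *: v)) addrC e; congr (_ + _).
by apply: eq_bigr => i _; rewrite liftK /= !(tnth_nth 0).
Qed.

End Span.

(** The preimage of [K] under [h] is a submodule. Scalars are constrained only through [K], so that
    [h] may be semilinear. *)
Lemma spanned_map (R S : comPzRingType) (V : lmodType R) (W : lmodType S)
    (K : W -> Prop) (h : V -> W) (g : seq V) x :
  is_submod K -> {morph h : u v / u + v} ->
  (forall a v, K (h v) -> K (h (a *: v))) ->
  {in g, forall v, K (h v)} -> spanned g x -> K (h x).
Proof.
move=> sK hD hZ Kg gx.
have h0 : h 0 = 0 by apply: (addrI (h 0)); rewrite -hD !addr0.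
apply: (@spanned_min _ _ (fun x => K (h x)) g) => //; split=> [|a u v Ku Kv].
  by rewrite h0; case: sK.
by rewrite hD; apply: is_submodD => //; apply: hZ.
Qed.

(** * Finitely generated modules over a Noetherian ring *)

Section Noetherian.
Variable R : comPzRingType.
Hypothesis noethR : noetherian R.

Lemma noetherian_ideal (K : R^o -> Prop) : is_submod K ->
  exists2 g, {in g, forall v, K v} & forall x, K x -> spanned g x.
Proof.
move=> sK; have [n [g gP]] := noethR (submod_pred sK).
exists [seq val (g i) | i : 'I_n].
  by move=> _ /imageP[i _ ->]; have /asboolP := valP (g i).
move=> x Kx; have Kx' : x \in submod_pred sK by apply/asboolP.
have [a e] := gP (SubmodType Kx').
rewrite (_ : x = val (SubmodType Kx')) // e raddf_sum.
apply: is_submod_sum => [|i _]; first exact: spanned_submod.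
apply: (is_submodZ (a i) (x := val (g i))); first exact: spanned_submod.
exact/spanned_mem/image_f.
Qed.

Variable V : lmodType R.
Implicit Types (K L : V -> Prop) (g h : seq V) (x y : V).

(** Induction on [g]. The possible coefficients at [v] of elements of [K], modulo the span of the
    other generators, form an ideal; lifts [h1] of its generators to [K], together with generators
    [h2] of the intersection of [K] with that span, generate [K]. *)
Lemma noetherian_submod g K : is_submod K -> (forall x, K x -> spanned g x) ->
  exists2 h, {in h, forall v, K v} & forall x, K x -> spanned h x.
Proof.
elim: g K => [|v g IHg] K sK Kg; first by exists [::].
have sg := spanned_submod g.
have [cs csI Ics] : exists2 s : seq R^o,
    {in s, forall a : R, exists2 x, K x & spanned g (x - a *: v)} &
    forall a : R, (exists2 x, K x & spanned g (x - a *: v)) -> spanned s (a : R^o).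
  apply: noetherian_ideal; split.
    by exists 0; [case: sK | rewrite scale0r subr0; case: sg].
  move=> a b c [x Kx xb] [y Ky yc]; exists (a *: x + y); first by case: sK => _; apply.
  have -> : a *: x + y - (a *: b + c : R) *: v = a *: (x - b *: v) + (y - c *: v).
    by rewrite scalerBr scalerDl scalerA opprD addrACA.
  by case: sg => _; apply.
have [h1 h1K h1P] : exists2 h, {in h, forall v, K v} &
    forall a : R, spanned cs (a : R^o) ->
      exists2 x, spanned h x & spanned g (x - a *: v).
  elim: cs csI {Ics} => [_|b s IHs sI].
    by exists [::] => // a /= ->; exists 0 => //; rewrite scale0r subr0; case: sg.
  have [c cc|h hK hP] := IHs; first by apply: sI; rewrite in_cons cc orbT.
  have [x Kx xb] := sI b (mem_head _ _); exists (x :: h).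
    by move=> w /predU1P[->//|/hK].
  move=> a /= [c /hP[y hy yc]]; exists (c *: x + y).
    by exists c; rewrite addrC addrA addNr add0r.
  have -> : c *: x + y - a *: v = c *: (x - b *: v) + (y - (a - c * b) *: v).
    rewrite scalerBr scalerBl scalerA opprB addrACA; congr (_ + _).
    by rewrite addrA addNr add0r.
  by case: sg => _; apply.
have [|x [] //|h2 h2K h2P] := IHg (fun x => K x /\ spanned g x).
  split; first by split; [case: sK | case: sg].
  by move=> a x y [Kx gx] [Ky gy]; split; [case: sK | case: sg] => _; apply.
exists (h1 ++ h2) => [w|x Kx]; first by rewrite mem_cat => /orP[/h1K|/h2K[]].
have sh := spanned_submod (h1 ++ h2).
have [a xa] := Kg x Kx.
(* [y] has the same coefficient at [v] as [x], so [x - y] falls under [h2]. *)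
have [|y h1y ya] := h1P a; first by apply: Ics; exists x.
rewrite -[x](subrK y); apply: is_submodD => //.
  apply: (spanned_min sh _ (h2P _ _)).
    by move=> w h2w; apply: spanned_mem; rewrite mem_cat h2w orbT.
  split; first by apply: is_submodB => //; apply: spanned_min h1y.
  have -> : x - y = (x - a *: v) - (y - a *: v) by rewrite opprB addrA subrK.
  exact: is_submodB.
apply: (spanned_min sh _ h1y).
by move=> w h1w; apply: spanned_mem; rewrite mem_cat h1w.
Qed.

Hypothesis fgV : fin_gen V.

(** The increasing union of the spans of the initial segments is finitely generated, hence equals
    one of them. *)
Lemma noetherian_seq (u : nat -> V) : exists k, spanned (mkseq u k) (u k).
Proof.
have mono m n x : (m <= n)%N -> spanned (mkseq u m) x -> spanned (mkseq u n) x.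
  move=> mn; apply: spanned_min; first exact: spanned_submod.
  move=> _ /mapP[i im ->]; apply/spanned_mem/map_f.
  by move: im; rewrite !mem_iota /= !add0n => /leq_trans ->.
have [g gP] := fin_gen_spanned fgV.
have [||h hK hP] := @noetherian_submod g (fun x => exists k, spanned (mkseq u k) x).
- split=> [|a x y [m xm] [n yn]]; first by exists 0%N.
  exists (maxn m n); apply: (spanned_submod _).2.
    by apply: mono xm; rewrite leq_maxl.
  by apply: mono yn; rewrite leq_maxr.
- by [].
have [k hk] : exists k, {in h, forall v, spanned (mkseq u k) v}.
  elim: h hK {hP} => [|v h IHh] hK; first by exists 0%N.
  have [w hw|k hk] := IHh; first by apply: hK; rewrite in_cons hw orbT.
  have [m vm] := hK v (mem_head _ _); exists (maxn m k) => w.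
  case/predU1P=> [->|/hk]; [apply: mono vm | apply: mono].
    by rewrite leq_maxl.
  by rewrite leq_maxr.
exists k; apply: spanned_min (spanned_submod _) hk _; apply: hP.
by exists k.+1; apply/spanned_mem/map_f; rewrite mem_iota ltnSn.
Qed.
End Noetherian.

Lemma spanned_mkseq (R : comPzRingType) (V : lmodType R) (u : nat -> V) k x :
  spanned (mkseq u k) x -> exists a : nat -> R, x = \sum_(0 <= i < k) a i *: u i.
Proof.
elim: k x => [|k IHk] x.
  by move=> /= ->; exists (fun=> 0); rewrite big_geq.
have rc : forall g (v y : V), spanned (rcons g v) y -> exists b, spanned g (y - b *: v).
  elim=> [|w g IHg] v y /=; first by case=> b; exists b.
  by case=> a /IHg[b gb]; exists b, a; rewrite addrAC.
rewrite mkseqS => /rc[b /IHk[a e]]; exists (fun i => if (i < k)%N then a i else b).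
rewrite big_nat_recr //= ltnn -[LHS](subrK (b *: u k)) e; congr (_ + _).
by apply: eq_big_nat => i /andP[_ ->].
Qed.

(** * Stationarity of a decreasing chain of submodules *)

Section Chain.
Variables (R : comPzRingType) (V : lmodType R).
Hypotheses (noethR : noetherian R) (fgV : fin_gen V).
Variables (L : V -> Prop) (K : nat -> V -> Prop).
Hypotheses (sL : is_submod L) (sK : forall e, is_submod (K e)).
Hypothesis LK : forall e x, L x -> K e x.
Hypothesis K_decr : forall e e' x, (e <= e')%N -> K e' x -> K e x.

(** The hypothesis abstracts from the associated prime: if [Q] is the annihilator of [r *: x] modulo
    [L], multiples by [s] in [Q] lie in [L], and those by [s] outside [Q] are to avoid [K e']. *)
Lemma chain_stationary :
  (forall e x, K e x -> ~ L x -> exists r : R, ~ L (r *: x) /\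
     exists e', forall s : R, K e' (s *: (r *: x)) -> L (s *: (r *: x))) ->
  exists e, forall x, K e x -> L x.
Proof.
move=> Kprime; apply: contrapT => /forallNP noe.
(* The pair holds an element chosen at index [e] and the index at which the next one is chosen. *)
have step e : exists y : V * nat, [/\ (e <= y.2)%N, K e y.1, ~ L y.1 &
    forall s : R, K y.2 (s *: y.1) -> L (s *: y.1)].
  have /existsNP[x /not_implyP[Kx Lx]] := noe e.
  have [r [Lrx [e' e'P]]] := Kprime e x Kx Lx.
  exists (r *: x, maxn e e'); split=> //=; first exact: leq_maxl.
    exact: is_submodZ.
  by move=> s Ks; apply: e'P; apply: K_decr Ks; rewrite leq_maxr.
have [F FP] := choice step.
pose e n := iter n (fun i => (F i).2) 0%N; pose u n := (F (e n)).1.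
have eS n : (e n <= e n.+1)%N by have [] := FP (e n).
have e_mono : {homo e : m n / (m <= n)%N} by apply: homo_leq => // ? ? ?; apply: leq_trans.
have Ku n : K (e n) (u n) by have [] := FP (e n).
have Lu n : ~ L (u n) by have [] := FP (e n).
have uL n s : K (e n.+1) (s *: u n) -> L (s *: u n) by have [_ _ _] := FP (e n); apply.
have [k /spanned_mkseq[a eu]] := noetherian_seq noethR fgV u.
(* The terms of this relation vanish modulo [L] one after the other: once the
   first [j] do, the [j]-th is congruent to a combination of later terms, so it
   lies in [K (e j.+1)]. *)
have term_L j : (j < k)%N -> L (a j *: u j).
  elim/ltn_ind: j => j IHj jk; apply: uL.
  have -> : a j *: u j = u k - \sum_(0 <= i < j) a i *: u i
      - \sum_(j.+1 <= i < k) a i *: u i.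
    rewrite eu (big_cat_nat (n := j)) //=; last exact: ltnW.
    by rewrite (big_ltn jk) [X in X - _ - _]addrC !addrK.
  have sKj := sK (e j.+1).
  apply: is_submodB => //; first apply: is_submodB => //.
  - exact: K_decr (e_mono _ _ jk) (Ku k).
  - apply: LK; rewrite big_nat; apply: is_submod_sum => // i /andP[_ ij].
    by apply: IHj => //; apply: ltn_trans jk.
  - rewrite big_nat; apply: is_submod_sum => // i /andP[ji _].
    by apply: is_submodZ => //; apply: K_decr (e_mono _ _ ji) (Ku i).
by apply: (Lu k); rewrite eu big_nat; apply: is_submod_sum.
Qed.
End Chain.

(** * Existence of associated primes *)

Section AssociatedPrime.
Variables (R : comPzRingType) (V : lmodType R).
Hypothesis noethR : noetherian R.
Variables (L : V -> Prop) (sL : is_submod L).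

(** Otherwise the annihilator of each [r *: x] outside [L] fails to be prime, through some pair
    [(a, b)]. Replacing [r] by [b * r] repeatedly gives [a n] that kills all later [r m *: x] modulo
    [L] but not [r n *: x]. By the chain condition some [a k] is a combination of earlier ones, all
    of which kill [r k *: x]. *)
Lemma ex_associated_prime x : ~ L x ->
  exists r : R, exists Q : prime_ideal R,
    forall s : R, ((s : R^o) \in Q) <-> L (s *: (r *: x)).
Proof.
move=> Lx; apply: contrapT => noQ.
have step r : exists ab : R * R, ~ L (r *: x) ->
    [/\ L (ab.1 *: (ab.2 *: (r *: x))), ~ L (ab.1 *: (r *: x))
      & ~ L (ab.2 *: (r *: x))].
  (* A dummy pair, which makes the choice of [(a, b)] total in [r]. *)
  case: (EM (L (r *: x))) => [Lrx|Lrx]; first by exists (0, 0).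
  apply: contrapT => noab; apply: noQ; exists r.
  pose I (s : R^o) := L ((s : R) *: (r *: x)).
  have sI : is_submod I.
    split=> [|a s t Is It]; first by rewrite /I scale0r; case: sL.
    by rewrite /I scalerDl -[(a *: s : R)]/(a * s) -scalerA; case: sL => _; apply.
  have I1 : (1 : R^o) \notin submod_pred sI.
    by apply/negP => /asboolP; rewrite /I scale1r.
  suff Imul a b : ((a * b : R) : R^o) \in submod_pred sI ->
      ((a : R^o) \in submod_pred sI) \/ ((b : R^o) \in submod_pred sI).
    by exists (PrimeIdeal I1 Imul) => s; split=> [/asboolP|Ls] //; apply/asboolP.
  move=> /asboolP Iab; apply: contrapT => /not_orP[Ia Ib].
  apply: noab; exists (a, b) => _; split.
  - by rewrite /= scalerA.
  - by move=> La; apply: Ia; apply/asboolP.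
  - by move=> Lb; apply: Ib; apply/asboolP.
have [F FP] := choice step.
pose r n := iter n (fun r => (F r).2 * r) 1; pose a n : R^o := (F (r n)).1.
have Lr n : ~ L (r n *: x).
  elim: n => [|n /FP[_ _]]; first by rewrite scale1r.
  by rewrite scalerA.
have La n : ~ L ((a n : R) *: (r n *: x)) by have [] := FP _ (Lr n).
have aL m n : (m < n)%N -> L ((a m : R) *: (r n *: x)).
  have [Lm _ _] := FP _ (Lr m).
  elim: n => // n IHn; rewrite ltnS leq_eqVlt => /predU1P[<-|/IHn {}IHn].
    by rewrite /= -scalerA.
  by rewrite /= scalerA mulrCA -scalerA; apply: is_submodZ => //; rewrite -scalerA.
have fgR : fin_gen (R^o : lmodType R).
  exists 1%N, (fun=> 1) => y; exists (fun=> y).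
  by rewrite big_ord1; rewrite -[LHS]mulr1.
have [k] := noetherian_seq noethR fgR a.
pose I (s : R^o) := L ((s : R) *: (r k *: x)).
suff sI : is_submod I.
  move=> /(spanned_min sI) Ik; apply: (La k); apply: Ik.
  by move=> _ /mapP[i ik ->]; apply: aL; rewrite mem_iota in ik.
split=> [|b s t Is It]; first by rewrite /I scale0r; case: sL.
by rewrite /I scalerDl -[(b *: s : R)]/(b * s) -scalerA; case: sL => _; apply.
Qed.
End AssociatedPrime.

(** * Semilinear and linear maps out of a base change *)

Section SemilinearBaseChange.
Variables (R S R' S' : comPzRingType) (f : R -> S) (f' : R' -> S').
Variables (M : lmodType R) (M' : lmodType R').
Variables (theta : R -> R') (phi : S -> S') (psi : M -> M').
Hypotheses (phi0 : phi 0 = 0) (phiD : {morph phi : a b / a + b}).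
Hypotheses (phiM : {morph phi : a b / a * b}).
Hypothesis phif : forall r, phi (f r) = f' (theta r).
Hypotheses (psiD : {morph psi : m n / m + n}).
Hypothesis psiZ : forall r m, psi (r *: m) = theta r *: psi m.

(** Applying [phi] and [psi] entrywise respects each defining relation of the tensor product. This
    serves both for Frobenius, with [phi] a power map, and for localization, with [phi] the map to
    the ring of fractions. *)
Lemma bc_semilinear : exists h : base_change f M -> base_change f' M',
  [/\ {morph h : x y / x + y}, forall a x, h (a *: x) = phi a *: h x
    & forall a m, h (tensor f a m) = tensor f' (phi a) (psi m)].
Proof.
pose F (s : seq (S * M)) := [seq (phi x.1, psi x.2) | x <- s].
have F_rel s t : tensor_rel f s t -> tensor_rel f' (F s) (F t).
  elim=> {s t}.
  - by move=> s; apply: tensor_refl.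
  - by move=> s t _; apply: tensor_sym.
  - by move=> t s u _ h1 _; apply: tensor_trans.
  - by move=> s s' t t' _ h1 _ h2; rewrite /F !map_cat; apply: tensor_cat.
  - by move=> s t; rewrite /F !map_cat; apply: tensor_catC.
  - by move=> m; rewrite /F /= phi0; apply: tensor_0l.
  - by move=> a b m; rewrite /F /= phiD; apply: tensor_Dl.
  - by move=> a m n; rewrite /F /= psiD; apply: tensor_Dr.
  - by move=> a r m; rewrite /F /= phiM phif psiZ; apply: tensor_M.
pose h (x : base_change f M) : base_change f' M' := bc_pi f' (F (repr x)).
have h_pi s : h (bc_pi f s) = bc_pi f' (F s) by apply/bc_piE/F_rel/repr_bc_pi.
exists h; split=> [x y|a x|a m]; last exact: h_pi.
  rewrite -[x]bc_pi_repr -[y]bc_pi_repr [_ + _]bc_add_pi !h_pi /F map_cat.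
  by rewrite [RHS]bc_add_pi.
rewrite -[x]bc_pi_repr [_ *: _]bc_scale_pi !h_pi [RHS]bc_scale_pi /F.
by rewrite /tensor_scale -!map_comp; congr bc_pi; apply: eq_map => y /=; rewrite phiM.
Qed.
End SemilinearBaseChange.

Lemma bc_lift_tensor (R S : comPzRingType) (f : R -> S) (M : lmodType R)
    (P : lmodType S) (g : M -> P) :
  {morph g : m n / m + n} -> (forall r m, g (r *: m) = f r *: g m) ->
  exists h : {linear base_change f M -> P},
    forall a m, h (tensor f a m) = a *: g m.
Proof.
move=> gD gZ.
pose hL := GRing.isLinear.Build S (base_change f M) P *:%R (bc_lift g)
  (bc_lift_linear gD gZ).
pose h : {linear base_change f M -> P} := HB.pack (bc_lift g) hL.
by exists h => a m; apply: bc_liftT.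
Qed.

Lemma is_submod_preim (R S : comPzRingType) (V : lmodType R) (U : lmodType S)
    (theta : R -> S) (h : V -> U) (N : submodClosed U) :
  {morph h : x y / x + y} -> (forall a x, h (a *: x) = theta a *: h x) ->
  is_submod (fun x => h x \in N).
Proof.
move=> hD hZ; split=> [|a x y Nx Ny]; last by rewrite hD hZ rpredD // rpredZ.
by rewrite (_ : h 0 = 0) ?rpred0 //; apply: (addrI (h 0)); rewrite -hD !addr0.
Qed.

(** * Frobenius powers of submodules *)

Section FrobeniusSubmodule.
Variables (p : nat) (R : comPzRingType) (M : lmodType R) (N : submodClosed M).
Variable e : nat.

Lemma frob_submod_tensor a n :
  n \in N -> (tensor (frob p e) a n : frob_mod p e M) \in frob_submod p e N.
Proof.
move=> Nn; apply/asboolP; exists (tensor (frob p e) a (SubmodType Nn)).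
by rewrite bc_mapT.
Qed.

(** N^[q] is spanned by the elements n^q, so inclusions of N^[q] are checked on these. *)
Lemma frob_submod_min (K : frob_mod p e M -> Prop) y :
  is_submod K -> (forall n, n \in N -> K (tensor (frob p e) 1 n)) ->
  y \in frob_submod p e N -> K y.
Proof.
move=> sK KN /asboolP[z ->]; have [s ->] := bc_spanned z.
rewrite raddf_sum; apply: is_submod_sum => // -[a n] _ /=.
rewrite (_ : bc_map _ _ = a *: tensor (frob p e) 1 (val n)).
  by apply: is_submodZ => //; apply: KN; apply: valP.
by rewrite tensorZl mulr1; apply: bc_mapT.
Qed.

Lemma frob_eltZ a u : frob_elt p e (a *: u : M) = a ^+ (p ^ e) *: frob_elt p e u.
Proof. by rewrite /frob_elt tensorZr tensorZl mulrC. Qed.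

End FrobeniusSubmodule.

Section IteratedFrobenius.
Variables (p : nat) (R : comPzRingType) (M : lmodType R) (N : submodClosed M).
Variables e e' : nat.

(** The linear map F^(e+e')(M) -> F^e'(F^e(M)) with 1 (x) m sent to 1 (x) (1 (x) m) takes N^[qq']
    into (N^[q])^[q']. *)
Lemma frob_elt_iter a b u :
  (a * b ^+ (p ^ e')) *: frob_elt p (e + e') u \in frob_submod p (e + e') N ->
  a *: frob_elt p e' (b *: frob_elt p e u) \in frob_submod p e' (frob_submod p e N).
Proof.
pose g (m : M) : frob_mod p e' (frob_mod p e M) := frob_elt p e' (frob_elt p e m).
have gD : {morph g : m n / m + n} by move=> m n; rewrite /g /frob_elt !tensorDr.
have gZ r m : g (r *: m) = frob p (e + e') r *: g m.
  by rewrite /g !frob_eltZ -exprM -expnD.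
have [h hT] := bc_lift_tensor gD gZ.
have sK : is_submod (fun x => h x \in frob_submod p e' (frob_submod p e N)).
  by apply: (is_submod_preim (theta := id)) => [x y|a' x]; rewrite ?linearD ?linearZ.
move=> /(frob_submod_min sK); rewrite linearZ hT scale1r /g frob_eltZ scalerA.
by apply=> n Nn; rewrite hT scale1r /g; do 2!apply: frob_submod_tensor.
Qed.

End IteratedFrobenius.

(** The map a (x) m -> a^q' (x) m from F^e(M) to F^(e+e')(M) is additive in characteristic p and
    takes N^[q] into N^[qq']. *)
Lemma frob_elt_expn (R : comNzRingType) (p : nat) (M : lmodType R)
    (N : submodClosed M) e e' (a : R) u : p \in [pchar R] ->
  a *: frob_elt p e u \in frob_submod p e N ->
  a ^+ (p ^ e') *: frob_elt p (e + e') u \in frob_submod p (e + e') N.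
Proof.
move=> charR; have p_pr := pcharf_prime charR.
have frobE (x : R) : frob p e' x = x ^+ (p ^ e') by [].
have [||||||h [hD hZ hT]] := @bc_semilinear R R R R (frob p e) (frob p (e + e'))
  M M id (frob p e') id.
- by rewrite frobE expr0n gtn_eqF // expn_gt0 prime_gt0.
- move=> x y; rewrite /frob; elim: e' {frobE} => [|k IHk]; first by rewrite !expr1.
  by rewrite expnSr !exprM IHk -!(pFrobenius_autE charR) rmorphD.
- by move=> x y; rewrite /frob exprMn.
- by move=> r; rewrite /frob -exprM expnD.
- by [].
- by [].
have sK := is_submod_preim (frob_submod p (e + e') N) hD hZ.
have hT1 m : h (tensor (frob p e) 1 m) = frob_elt p (e + e') m.
  by rewrite hT /frob expr1n.
move=> /(frob_submod_min sK); rewrite hZ hT1; apply => n Nn.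
by rewrite hT1; apply: frob_submod_tensor.
Qed.


Lemma frob_submod0 (p : nat) (R : comPzRingType) (M : lmodType R)
    (N : submodClosed M) (a : R) u :
  a *: frob_elt p 0 u \in frob_submod p 0 N -> a *: u \in N.
Proof.
have gD : {morph (@id M) : m n / m + n} by [].
have gZ (r : R) (m : M) : id (r *: m) = frob p 0 r *: id m by [].
have [h hT] := bc_lift_tensor gD gZ.
have sK : is_submod (fun x => h x \in N).
  by apply: (is_submod_preim (theta := id)) => [x y|a' x]; rewrite ?linearD ?linearZ.
move=> /(frob_submod_min sK); rewrite linearZ hT scale1r.
by apply=> n Nn; rewrite hT scale1r.
Qed.

(** The last condition on [h] says that its image generates [U], as an induction principle; the
    images of generators of [V] then generate [U]. *)
Lemma fin_gen_semilinear (R S : comPzRingType) (V : lmodType R) (U : lmodType S)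
    (theta : R -> S) (h : V -> U) :
  {morph h : x y / x + y} -> (forall a x, h (a *: x) = theta a *: h x) ->
  (forall K, is_submod K -> (forall x, K (h x)) -> forall y, K y) ->
  fin_gen V -> fin_gen U.
Proof.
move=> hD hZ Uh /fin_gen_spanned[g gP]; apply: (@spanned_fin_gen _ _ (map h g)).
have sK := spanned_submod (map h g).
apply: Uh => // x; apply: spanned_map (gP x) => // [a v|v gv].
  by rewrite hZ; apply: is_submodZ.
exact/spanned_mem/map_f.
Qed.

Lemma fin_gen_frob_mod (p : nat) (R : comPzRingType) (M : lmodType R) e :
  fin_gen M -> fin_gen (frob_mod p e M).
Proof.
apply: (fin_gen_semilinear (theta := fun a => a ^+ (p ^ e))
  (h := frob_elt p e : M -> frob_mod p e M)).
- by move=> x y; rewrite /frob_elt tensorDr.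
- exact: frob_eltZ.
move=> K sK Kh y; have [s ->] := bc_spanned y.
apply: is_submod_sum => // -[a m] _ /=.
by have := is_submodZ a sK (Kh m); rewrite [_ *: _]tensorZl mulr1.
Qed.

Lemma fin_gen_frob_submod (p : nat) (R : comPzRingType) (M : lmodType R)
    (N : submodClosed M) e :
  fin_gen (submod_type N) -> fin_gen (submod_type (frob_submod p e N)).
Proof.
move/(@fin_gen_frob_mod p _ _ e).
have Nz z : bc_map (f := frob p e) (val : {linear submod_type N -> M}) z
    \in frob_submod p e N by apply/asboolP; exists z.
apply: (fin_gen_semilinear (theta := id) (h := fun z => SubmodType (Nz z))).
- by move=> x y; apply: val_inj; rewrite /= raddfD.
- by move=> a x; apply: val_inj; rewrite /= linearZ.
by move=> K sK Kh [y Ny]; have /asboolP[z yz] := Ny;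
  rewrite (_ : SubmodType _ = SubmodType (Nz z)) //; apply: val_inj.
Qed.

(** The test property of [c] for the pair N^[q] in F^e(M), read at the power 1. *)
Lemma test_element_frob (p : nat) (R : comPzRingType) (M : lmodType R)
    (N : submodClosed M) (c : R) e u :
  test_element p c -> fin_gen M -> fin_gen (submod_type N) ->
  c *: frob_elt p e u \in tight_closure p (frob_submod p e N) ->
  (c * c) *: frob_elt p e u \in frob_submod p e N.
Proof.
move=> [_ c_test] fgM fgN.
have fgF := fin_gen_frob_mod p e fgM; have fgFN := fin_gen_frob_submod p e fgN.
have [test_c _] := c_test _ _ fgF fgFN (c *: frob_elt p e u).
by move/test_c => /(_ 0%N)/frob_submod0; rewrite scalerA.
Qed.

(** * Fractions, and Frobenius powers of localized submodules *)

Section LocalizationImage.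
Variables (R : comPzRingType) (W : mulrClosed R).

Lemma frac_scale (M : lmodType R) (c : R) v (m : M) w :
  (frac (c : R^o) v : loc_ring W) *: frac m w = frac (c *: m) (denomM v w).
Proof. exact: loc_scale_frac. Qed.

Lemma frac_mul (a b : R) v w :
  (frac (a : R^o) v : loc_ring W) * (frac (b : R^o) w : loc_ring W) =
  frac (a * b : R^o) (denomM v w).
Proof. exact: loc_scale_frac. Qed.

Lemma frac1D (M : lmodType R) :
  {morph (fun m : M => frac m (denom1 W)) : m n / m + n}.
Proof.
by move=> m n; rewrite fracD; apply: frac_eq => /=; rewrite !scale1r mulr1 scale1r.
Qed.

Lemma fracZ (M : lmodType R) (r : R) (m : M) w :
  frac (r *: m) w = loc_image W r *: frac m w.
Proof. by rewrite frac_scale; apply: frac_eq => /=; rewrite mul1r. Qed.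

Lemma frac_denom (M : lmodType R) (m : M) w :
  frac m w = (frac (1 : R^o) w : loc_ring W) *: frac m (denom1 W).
Proof. by rewrite frac_scale scale1r; apply: frac_eq => /=; rewrite mulr1. Qed.

Lemma loc_image_unit w : w \in W -> exists a : loc_ring W, a * loc_image W w = 1.
Proof.
move=> Ww; exists (frac (1 : R^o) (exist _ w Ww)); rewrite frac_mul mul1r.
by apply: frac_eq => /=; rewrite mulr1 scale1r [RHS]mulr1.
Qed.

Lemma loc_imageM : {morph loc_image W : a b / a * b}.
Proof. by move=> a b; rewrite frac_mul; apply: frac_eq => /=; rewrite mulr1. Qed.

Lemma loc_image1 : loc_image W 1 = 1. Proof. by []. Qed.

Lemma loc_imageD : {morph loc_image W : a b / a + b}.
Proof. exact: (@frac1D R^o). Qed.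

Lemma loc_image0 : loc_image W 0 = 0. Proof. by []. Qed.

Lemma loc_imageX k : {morph loc_image W : a / a ^+ k}.
Proof. by move=> a; elim: k => // k IHk; rewrite !exprS loc_imageM IHk. Qed.

Lemma denomX_subproof (w : denom W) k : val w ^+ k \in W.
Proof. by rewrite rpredX ?(valP w). Qed.
Definition denomX (w : denom W) k : denom W :=
  exist _ (val w ^+ k) (denomX_subproof w k).

Lemma frac_exp (a : R) v k :
  (frac (a : R^o) v : loc_ring W) ^+ k = frac (a ^+ k : R^o) (denomX v k).
Proof.
elim: k => [|k IHk].
  by rewrite expr0; apply: frac_eq; rewrite /= !expr0.
by rewrite exprS IHk frac_mul -exprS; apply: frac_eq => /=; rewrite exprS.
Qed.
End LocalizationImage.

Section LocSubmod.
Variables (R : comPzRingType) (W : mulrClosed R) (M : lmodType R).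
Variable N : submodClosed M.

Lemma frac_loc_submod n w : n \in N -> frac n w \in loc_submod W N.
Proof. by move=> Nn; apply/asboolP; exists n => //; exists w. Qed.

Lemma loc_submodP u w :
  frac u w \in loc_submod W N <-> exists2 s, s \in W & s *: u \in N.
Proof.
split=> [/asboolP[n Nn [v /fracE[t Wt e]]]|[s Ws Nsu]].
  exists (t * val v); first by rewrite rpredM // (valP v).
  by rewrite e rpredZ.
rewrite (_ : frac u w = frac (s *: u) (denomM (exist _ s Ws) w)).
  exact: frac_loc_submod.
by apply: frac_eq => /=; rewrite scalerA mulrC.
Qed.

End LocSubmod.

Section LocalizationFrobenius.
Variables (p : nat) (R : comPzRingType) (W : mulrClosed R) (M : lmodType R).
Variable N : submodClosed M.

(** Frobenius powers commute with localization. Forwards, (m/w)^q -> m^q/w^q defines a map from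
    F^e(M_W) to F^e(M)_W; backwards, F^e(M) maps to F^e(M_W) and [s] becomes invertible. *)
Lemma frob_submod_loc e (a : R) (u : M) :
  loc_image W a *: frob_elt p e (frac u (denom1 W))
    \in frob_submod p e (loc_submod W N)
  <-> exists2 s, s \in W & (s * a) *: frob_elt p e u \in frob_submod p e N.
Proof.
split.
  pose g (x : loc_mod W M) : loc_mod W (frob_mod p e M) :=
    frac (frob_elt p e (repr x).1) (denomX (repr x).2 (p ^ e)).
  have g_frac m w : g (frac m w) = frac (frob_elt p e m) (denomX w (p ^ e)).
    rewrite /g; have [t Wt ew] := repr_frac m w; apply/fracE.
    (* If [t] witnesses the equality of two fractions, t^q witnesses that of their q-th powers. *)
    by exists (t ^+ (p ^ e)); rewrite ?rpredX //= -!exprMn -!frob_eltZ ew.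
  have gD : {morph g : x y / x + y}.
    move=> x y; have [m [v ->]] := fracP x; have [n [w ->]] := fracP y.
    rewrite fracD !g_frac fracD; apply: frac_eq => /=.
    by rewrite /frob_elt tensorDr -!/(frob_elt p e _) !frob_eltZ exprMn.
  have gZ (r : loc_ring W) x : g (r *: x) = frob p e r *: g x.
    have [b [v ->]] := fracP r; have [m [w ->]] := fracP x.
    rewrite frac_scale !g_frac /frob frac_exp frac_scale frob_eltZ.
    by apply: frac_eq => /=; rewrite exprMn.
  have [h hT] := bc_lift_tensor gD gZ.
  have sK : is_submod (fun x => h x \in loc_submod W (frob_submod p e N)).
    by apply: (is_submod_preim (theta := id)) => [x y|r x]; rewrite ?linearD ?linearZ.
  have ha : h (loc_image W a *: frob_elt p e (frac u (denom1 W))) =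
      frac (a *: frob_elt p e u) (denomX (denom1 W) (p ^ e)).
    by rewrite linearZ hT scale1r g_frac [RHS]fracZ.
  move=> /(frob_submod_min sK); rewrite ha => hN.
  suff /hN/loc_submodP[s Ws] : forall n, n \in loc_submod W N ->
      h (tensor (frob p e) 1 n) \in loc_submod W (frob_submod p e N).
    by rewrite scalerA => Ns; exists s.
  move=> _ /asboolP[m Nm [w ->]]; rewrite hT scale1r g_frac.
  by apply: frac_loc_submod; apply: frob_submod_tensor.
case=> s Ws Ns; have [b bs] := loc_image_unit Ws.
rewrite -[loc_image W a]mul1r -bs -mulrA -scalerA -loc_imageM; apply: rpredZ.
have [||||||h [hD hZ hT]] := @bc_semilinear R R (loc_ring W) (loc_ring W)
  (frob p e) (frob p e) M (loc_mod W M) (loc_image W) (loc_image W)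
  (fun m => frac m (denom1 W)).
- exact: loc_image0.
- exact: loc_imageD.
- exact: loc_imageM.
- exact: loc_imageX.
- exact: frac1D.
- by move=> r m; apply: fracZ.
have sK := is_submod_preim (frob_submod p e (loc_submod W N)) hD hZ.
move/(frob_submod_min sK): Ns; rewrite hZ hT loc_image1; apply=> n Nn.
rewrite hT; apply: frob_submod_tensor; exact: frac_loc_submod.
Qed.

Lemma fin_gen_loc_mod : fin_gen M -> fin_gen (loc_mod W M).
Proof.
apply: (fin_gen_semilinear (theta := loc_image W)) (@frac1D _ W M)
  (fun r m => @fracZ _ W M r m _) _.
move=> K sK Kh y; have [m [w ->]] := fracP y.
by rewrite frac_denom; apply: is_submodZ.
Qed.

Lemma fin_gen_loc_submod :
  fin_gen (submod_type N) -> fin_gen (submod_type (loc_submod W N)).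
Proof.
have Nz (n : submod_type N) : frac (val n) (denom1 W) \in loc_submod W N.
  exact/frac_loc_submod/valP.
apply: (fin_gen_semilinear (theta := loc_image W) (h := fun n => SubmodType (Nz n))).
- by move=> x y; apply: val_inj; rewrite /= -frac1D.
- by move=> a x; apply: val_inj; rewrite /= -fracZ.
move=> K sK Kh [y Ny]; have /asboolP[n Nn [w yE]] := Ny.
rewrite (_ : SubmodType _ =
  (frac (1 : R^o) w : loc_ring W) *: SubmodType (Nz (SubmodType Nn))).
  exact: is_submodZ.
by apply: val_inj; rewrite /= yE frac_denom.
Qed.
End LocalizationFrobenius.

(** * Primes of a ring of fractions and the complement of the minimal ones *)

Section LocalizationPrime.
Variables (R : comPzRingType) (W : mulrClosed R).

Lemma prime_loc_image (P' : prime_ideal (loc_ring W)) w :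
  w \in W -> (loc_image W w : (loc_ring W)^o) \notin P'.
Proof.
move=> /loc_image_unit[a aw]; apply/negP => Pw.
by have := prime_proper P'; rewrite -aw (rpredZ a Pw).
Qed.

Lemma prime_frac (P' : prime_ideal (loc_ring W)) (r : R) w :
  ((frac (r : R^o) w : loc_ring W) : (loc_ring W)^o) \in P' <->
  (loc_image W r : (loc_ring W)^o) \in P'.
Proof.
split=> Pr.
  rewrite (_ : loc_image W r = loc_image W (val w) * (frac (r : R^o) w : loc_ring W)).
    exact: (rpredZ _ Pr).
  by rewrite frac_mul; apply: frac_eq => /=; rewrite mul1r [RHS]mul1r.
by rewrite frac_denom; apply: rpredZ.
Qed.

Lemma prime_contraction (P' : prime_ideal (loc_ring W)) :
  exists P : prime_ideal R, forall r : R,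
    ((r : R^o) \in P) <-> ((loc_image W r : (loc_ring W)^o) \in P').
Proof.
pose I (r : R^o) := (loc_image W r : (loc_ring W)^o) \in P'.
have sI : is_submod I.
  split=> [|a x y Ix Iy]; rewrite /I ?loc_image0 ?rpred0 //.
  by rewrite loc_imageD rpredD // [loc_image W _]loc_imageM; apply: (rpredZ _ Ix).
have I1 : (1 : R^o) \notin submod_pred sI.
  by apply/negP => /asboolP; rewrite /I loc_image1; apply/negP/prime_proper.
have Imul a b : ((a * b : R) : R^o) \in submod_pred sI ->
    ((a : R^o) \in submod_pred sI) \/ ((b : R^o) \in submod_pred sI).
  by move/asboolP; rewrite /I loc_imageM => /prime_mul[] ?; [left|right]; apply/asboolP.
by exists (PrimeIdeal I1 Imul) => r; split=> [/asboolP|Ir] //; apply/asboolP.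
Qed.

Lemma prime_extension (P : prime_ideal R) : (forall w, w \in W -> (w : R^o) \notin P) ->
  exists P' : prime_ideal (loc_ring W), forall (r : R) w,
    ((frac (r : R^o) w : loc_ring W) : (loc_ring W)^o) \in P' <-> (r : R^o) \in P.
Proof.
move=> WP.
have PE (r : R) w : (frac (r : R^o) w \in loc_submod W P) <-> (r : R^o) \in P.
  split=> [/loc_submodP[s Ws]|Pr]; last exact: frac_loc_submod.
  by move=> /prime_mul[] // Ps; have := WP s Ws; rewrite Ps.
pose I (x : (loc_ring W)^o) := (x : loc_mod W R^o) \in loc_submod W P.
have sI : is_submod I by split=> [|a x y Ix Iy]; rewrite /I ?rpred0 // rpredD // rpredZ.
have I1 : (1 : (loc_ring W)^o) \notin submod_pred sI.
  by apply/negP => /asboolP/PE; apply/negP/prime_proper.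
have Imul (a b : loc_ring W) :
    ((a * b : loc_ring W) : (loc_ring W)^o) \in submod_pred sI ->
    ((a : (loc_ring W)^o) \in submod_pred sI) \/
    ((b : (loc_ring W)^o) \in submod_pred sI).
  have [r [v ->]] := fracP a; have [s [w ->]] := fracP b.
  rewrite frac_mul => /asboolP/PE/prime_mul[] ?; [left|right]; exact/asboolP/PE.
exists (PrimeIdeal I1 Imul) => r w; split=> [/asboolP/PE //|Pr].
exact/asboolP/PE.
Qed.

(** A prime [P0] inside the contraction [P] misses [W], so it extends to a prime inside [P'], which
    is [P'] by minimality. *)
Lemma minimal_contraction (P' : prime_ideal (loc_ring W)) (P : prime_ideal R) :
  (forall r : R, ((r : R^o) \in P) <-> ((loc_image W r : (loc_ring W)^o) \in P')) ->
  minimal_prime P' -> minimal_prime P.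
Proof.
move=> PE minP' P0 P0P r /PE Pr.
have [w Ww|P0' P0E] := @prime_extension P0.
  by apply/negP => /P0P/PE; apply/negP/prime_loc_image.
apply/(P0E _ (denom1 W))/minP' => // x; have [s [w ->]] := fracP x.
by move=> /P0E/P0P/PE P's; apply/prime_frac.
Qed.

Lemma minimal_extension (P' : prime_ideal (loc_ring W)) (P : prime_ideal R) :
  (forall (r : R) w,
    ((frac (r : R^o) w : loc_ring W) : (loc_ring W)^o) \in P' <-> (r : R^o) \in P) ->
  minimal_prime P -> minimal_prime P'.
Proof.
move=> PE minP Q' QP x; have [r [w ->]] := fracP x => /PE Pr.
have [Q QE] := prime_contraction Q'.
by apply/prime_frac/QE; apply: minP Pr => s /QE/QP/PE.
Qed.

Lemma circ_loc_image (c : R) : circ c -> circ (loc_image W c).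
Proof.
move=> circ_c P' minP'; have [P PE] := prime_contraction P'.
by apply/negP => /PE; apply/negP/circ_c/(minimal_contraction PE).
Qed.

End LocalizationPrime.

(** A minimal prime over [V] contracts to a minimal prime of [R] that misses [V], hence [W], and so
    extends to a minimal prime over [W]. *)
Lemma circ_loc_image_sub (R : comPzRingType) (V W : mulrClosed R) (c : R) :
  {subset W <= V} -> circ (loc_image W c) -> circ (loc_image V c).
Proof.
move=> WV circ_c P' minP'; have [P PE] := prime_contraction P'.
have minP := minimal_contraction PE minP'.
have [w Ww|PW PWE] := @prime_extension _ W P.
  by apply/negP => /PE; apply/negP/prime_loc_image/WV.
apply/negP => /PE/PWE Pc.
by have := circ_c _ (minimal_extension PWE minP); rewrite Pc.
Qed.

(** * The submodules [K_e] and their localization *)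

Section EventualClosure.
Variables (p : nat) (R : comPzRingType) (c : R) (M : lmodType R).
Variable N : submodClosed M.

(* In terms of [q = p ^ e], this says [c u^q \in (N^[q])^*] (see
   [eventual_closure_tight]); writing it inside the modules [F^E(M)] avoids
   iterated Frobenius functors. *)
Definition eventual_closure (e : nat) (u : M) :=
  exists2 d : R, circ d & exists E0, forall E, (E0 <= E)%N ->
    (d * c ^+ (p ^ (E - e))) *: frob_elt p E u \in frob_submod p E N.

Lemma eventual_closure_submod e : is_submod (eventual_closure e).
Proof.
split=> [|a u v [d circ_d [E0 hu]] [d' circ_d' [E1 hv]]].
  exists 1; first exact: circ1.
  exists 0%N => E _; rewrite -[0](scale0r 0) frob_eltZ scalerA.
  by apply/rpredZ/frob_submod_tensor/rpred0.
exists (d * d'); first exact: circM.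
exists (maxn E0 E1) => E; rewrite geq_max => /andP[/hu {}hu /hv {}hv].
rewrite frob_elt_lin scalerDr rpredD //; set b := c ^+ _ in hu hv *.
  have -> : d * d' * b *: (frob p E a *: frob_elt p E u) =
      (d' * frob p E a) *: ((d * b) *: frob_elt p E u).
    by rewrite !scalerA; congr (_ *: _); ring.
  exact: rpredZ.
by rewrite -[d * d' * b]mulrA -scalerA rpredZ.
Qed.

(** Lowering [e] only raises the exponent of [c]. *)
Lemma eventual_closure_decr e e' u : (0 < p)%N -> (e <= e')%N ->
  eventual_closure e' u -> eventual_closure e u.
Proof.
move=> p_gt0 ee' [d circ_d [E0 hu]]; exists d => //; exists E0 => E /hu {}hu.
have le_q : (p ^ (E - e') <= p ^ (E - e))%N by rewrite leq_pexp2l // leq_sub2l.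
by rewrite -(subnK le_q) exprD mulrCA -scalerA rpredZ.
Qed.

Lemma tight_closure_eventual e u : u \in tight_closure p N -> eventual_closure e u.
Proof.
case/asboolP=> d circ_d [E0 hu]; exists d => //; exists E0 => E /hu {}hu.
by rewrite mulrC -scalerA rpredZ.
Qed.

Lemma eventual_closure_tight e u : eventual_closure e u ->
  c *: frob_elt p e u \in tight_closure p (frob_submod p e N).
Proof.
case=> d circ_d [E0 hu]; apply/asboolP; exists d => //; exists E0 => e' le_e'.
apply: frob_elt_iter; have := hu (e + e')%N (leq_trans le_e' (leq_addl _ _)).
by rewrite addKn.
Qed.

(** The multiplier [d] in [eventual_closure] may vary with [e]. The test property replaces it by
    [c], which leaves the multiplier [c * c] for all [e] at once. *)
Lemma eventual_closure_all u :
  test_element p c -> fin_gen M -> fin_gen (submod_type N) ->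
  (forall e, eventual_closure e u) -> u \in tight_closure p N.
Proof.
move=> test_c fgM fgN hu; apply/asboolP.
exists (c * c); first by case: test_c => circ_c _; apply: circM.
exists 0%N => e _; apply: test_element_frob => //.
exact: eventual_closure_tight.
Qed.

Variable W : mulrClosed R.

Lemma tight_closure_loc u : u \in tight_closure p N ->
  frac u (denom1 W) \in tight_closure p (loc_submod W N).
Proof.
case/asboolP=> d circ_d [E0 hu]; apply/asboolP.
exists (loc_image W d); first exact: circ_loc_image.
exists E0 => E /hu {}hu; apply/frob_submod_loc; exists 1; first exact: rpred1.
by rewrite mul1r.
Qed.
End EventualClosure.

Lemma eventual_closure_loc (p : nat) (R : comPzRingType) (c : R) (M : lmodType R)
    (N : submodClosed M) (W : mulrClosed R) e s u : s \in W ->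
  eventual_closure p c N e (s *: u) ->
  eventual_closure p (loc_image W c) (loc_submod W N) e (frac u (denom1 W)).
Proof.
move=> Ws [d circ_d [E0 hu]]; exists (loc_image W d); first exact: circ_loc_image.
exists E0 => E /hu; rewrite frob_eltZ scalerA => {}hu.
rewrite -loc_imageX -loc_imageM; apply/frob_submod_loc.
by exists (s ^+ (p ^ E)); rewrite ?rpredX // mulrC.
Qed.

(** * Passing to a larger multiplicative system and testing membership at primes *)

Lemma frac_mem (R : comPzRingType) (W : mulrClosed R) (M : lmodType R)
    (K : submodClosed (loc_mod W M)) u w :
  (frac u w \in K) = (frac u (denom1 W) \in K).
Proof.
apply/idP/idP => Ku; last by rewrite frac_denom rpredZ.
rewrite (_ : frac u _ = loc_image W (val w) *: frac u w) ?rpredZ //.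
by rewrite -fracZ; apply: frac_eq => /=; rewrite scale1r.
Qed.

(** The multiplier d/v may be replaced by d/1, as v/1 is a unit; [d] then has an image over [V], and
    no iterated localization is formed. *)
Lemma tight_closure_loc_sub (p : nat) (R : comPzRingType) (M : lmodType R)
    (N : submodClosed M) (V W : mulrClosed R) u : {subset W <= V} ->
  frac u (denom1 W) \in tight_closure p (loc_submod W N) ->
  frac u (denom1 V) \in tight_closure p (loc_submod V N).
Proof.
move=> WV /asboolP[d' circ_d' [E0 hu]]; have [d [v dE]] := fracP d'.
have d'Z : loc_image W d = loc_image W (val v) * d'.
  by rewrite dE frac_mul; apply: frac_eq => /=; rewrite mul1r [RHS]mul1r.
apply/asboolP; exists (loc_image V d).
  apply: circ_loc_image_sub WV _; rewrite d'Z; apply: circM => // P' _.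
  by apply: prime_loc_image; apply: valP v.
exists E0 => E /hu {}hu.
have : loc_image W d *: frob_elt p E (frac u (denom1 W))
    \in frob_submod p E (loc_submod W N) by rewrite d'Z -scalerA rpredZ.
case/frob_submod_loc => s Ws Ns; apply/frob_submod_loc.
by exists s => //; apply: WV.
Qed.

(** Let [L] be the saturation of [K] by [W]. If [x] is outside [L], some [r *: x] has a prime
    annihilator [Q] modulo [L]. This [Q] misses [W], yet contains every [s] with [s *: x] in [K]. *)
Lemma locally_mem (R : comPzRingType) (V : lmodType R) (K : submodClosed V)
    (W : mulrClosed R) (x : V) : noetherian R ->
  (forall Q : prime_ideal R, {subset W <= prime_compl Q} ->
     exists2 s, s \in prime_compl Q & s *: x \in K) ->
  exists2 w, w \in W & w *: x \in K.
Proof.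
move=> noethR hQ; apply: contrapT => noW.
pose L (y : V) := exists2 w, w \in W & w *: y \in K.
have sL : is_submod L.
  split=> [|a y z [v Wv Ky] [w Ww Kz]].
    by exists 1; rewrite ?rpred1 // scaler0 rpred0.
  exists (v * w); first exact: rpredM.
  rewrite scalerDr rpredD //; last by rewrite -scalerA rpredZ.
  have -> : (v * w) *: (a *: y) = (w * a) *: (v *: y).
    by rewrite !scalerA; congr (_ *: _); ring.
  exact: rpredZ.
have [r [Q QE]] := ex_associated_prime noethR sL noW.
have [w Ww|s] := hQ Q.
  rewrite inE; apply/negP => /QE[v Wv]; rewrite !scalerA => Kx.
  have := prime_proper Q; apply/negP/negPn/QE.
  by exists (v * w); [exact: rpredM | rewrite !scalerA mulr1].
rewrite inE => /negP Qs Kx; apply/Qs/QE; exists 1; first exact: rpred1.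
by rewrite scale1r scalerA mulrC -scalerA rpredZ.
Qed.

(** * Test exponents, and commutation with localization *)

Section Main.
Variables (R : comNzRingType) (p : nat) (M : lmodType R) (N : submodClosed M).
Hypotheses (charR : p \in [pchar R]) (noethR : noetherian R).
Hypotheses (fgM : fin_gen M) (fgN : fin_gen (submod_type N)).

Lemma ex_test_exponent (c : R) :
  (forall Q : prime_ideal R, associated (quot_mod (tight_closure p N)) Q ->
     tight_closure p (loc_submod (prime_compl Q) N) =i
       loc_submod (prime_compl Q) (tight_closure p N)) ->
  (forall Q : prime_ideal R, associated (quot_mod (tight_closure p N)) Q ->
     test_element p (loc_image (prime_compl Q) c)) ->
  exists e, test_exponent p c N e.
Proof.
move=> locN testQ; have p_gt1 := prime_gt1 (pcharf_prime charR).
have p_gt0 := ltnW p_gt1; pose L u := u \in tight_closure p N.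
have [|||||e eL] := chain_stationary noethR fgM (L := L)
  (K := eventual_closure p c N).
- exact: is_submod_mem.
- exact: eventual_closure_submod.
- by move=> e u; apply: tight_closure_eventual.
- by move=> e e' u; apply: eventual_closure_decr.
- move=> e0 x _ Lx.
  have [r [Q QE]] := ex_associated_prime noethR (is_submod_mem _) Lx.
  have assQ : associated (quot_mod (tight_closure p N)) Q.
    exists (quot_pi (tight_closure p N) (r *: x)) => s.
    rewrite [_ *: _]quot_scale_pi (_ : 0 = quot_pi (tight_closure p N) 0).
      by rewrite QE quot_piE subr0.
    by apply/(addrI (quot_pi (tight_closure p N) 0)); rewrite -quot_piD !addr0.
  exists r; split.
    have := prime_proper Q; apply: contraNnot => Lrx.
    by apply/QE; rewrite scale1r.
  apply: contrapT => /forallNP noe.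
  have : frac (r *: x) (denom1 (prime_compl Q)) \in
      tight_closure p (loc_submod (prime_compl Q) N).
    apply: (eventual_closure_all (testQ Q assQ)) => [||e].
    - exact: fin_gen_loc_mod.
    - exact: fin_gen_loc_submod.
    have /existsNP[s /not_implyP[Ks Ls]] := noe e.
    by apply: eventual_closure_loc Ks; rewrite inE; apply/negP => /QE.
  by rewrite locN // => /loc_submodP[s]; rewrite inE => /negP Qs /QE.
exists e => u e'; rewrite leq_exp2l // => ee' hu; apply: eL.
(* At [e'] the multiplier 1 works from [e'] on: Frobenius raises c u^Q' in N^[Q'] to all higher
   powers. *)
apply: eventual_closure_decr ee' _ => //; exists 1; first exact: circ1.
exists e' => E /subnK <-; rewrite mul1r addnK addnC.
exact: frob_elt_expn.
Qed.

Lemma tight_closure_loc_comm (c : R) e (W : mulrClosed R) :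
  locally_stable_test_element p c -> test_exponent p c N e ->
  tight_closure p (loc_submod W N) =i loc_submod W (tight_closure p N).
Proof.
move=> [_ testQ] test_e x; have [u [w ->]] := fracP x.
apply/idP/idP; last first.
  case/loc_submodP => s Ws /(tight_closure_loc W) Nsu.
  rewrite frac_mem; have [b bs] := loc_image_unit Ws.
  by rewrite -[frac u _]scale1r -bs -scalerA rpredZ // -fracZ.
rewrite frac_mem => Nu.
have [Q WQ|s Ws] := @locally_mem _ _ (frob_submod p e N) W
  (c *: frob_elt p e u) noethR.
  have NQu := tight_closure_loc_sub WQ Nu.
  have [_ tQ] := testQ Q.
  have [tu _] := tQ _ _ (fin_gen_loc_mod (prime_compl Q) fgM)
    (fin_gen_loc_submod (prime_compl Q) fgN) (frac u (denom1 _)).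
  (* The local test property is read only at the power of the test exponent. *)
  have /frob_submod_loc[s Qs] := tu NQu e.
  by exists s => //; rewrite scalerA.
rewrite scalerA => Nsu; apply/loc_submodP; exists s => //.
apply: (test_e _ e) => //; rewrite frob_eltZ scalerA.
have p_gt0 := prime_gt0 (pcharf_prime charR).
have q_gt0 : (0 < p ^ e)%N by rewrite expn_gt0 p_gt0.
(* c s^q = s^(q-1) (s c), as q is positive. *)
by rewrite -(prednK q_gt0) exprS mulrCA mulrA mulrC -scalerA rpredZ.
Qed.
End Main.

Theorem theorem2p4 (R : comNzRingType) (p : nat) (charR : p \in [pchar R])
    (redR : reduced R) (noethR : noetherian R)
    (M : lmodType R) (N : submodClosed M)
    (fgM : fin_gen M) (fgN : fin_gen (submod_type N))
    (locN : forall Q : prime_ideal R,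
       associated (quot_mod (tight_closure p N)) Q ->
       tight_closure p (loc_submod (prime_compl Q) N) =i
         loc_submod (prime_compl Q) (tight_closure p N)) :
  [/\ forall c : R, test_element p c ->
        (forall Q : prime_ideal R,
           associated (quot_mod (tight_closure p N)) Q ->
           test_element p (loc_image (prime_compl Q) c)) ->
        exists e : nat, test_exponent p c N e,
      forall c : R, locally_stable_test_element p c ->
        exists e : nat, test_exponent p c N e
    & (exists c : R, locally_stable_test_element p c) ->
      forall W : mulrClosed R,
        tight_closure p (loc_submod W N) =i loc_submod W (tight_closure p N)].
Proof.
have test_exp c : locally_stable_test_element p c ->
    exists e, test_exponent p c N e.
  by move=> [_ testQ]; apply: ex_test_exponent.
split=> // [c _ testQ|[c lst_c] W]; first exact: ex_test_exponent.
have [e test_e] := test_exp c lst_c.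
exact: tight_closure_loc_comm lst_c test_e.
Qed.
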